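(* Let $G$ be a group which has finite $C$-width. Then every quotient group of $G$ has finite $C$-width.
   Context: For a group $G$ and a generating set $S$ of $G$, the length $l_S(g)$ of $g\in G$ is the minimum number of elements of $S\cup S^{-1}$ needed to express $g$ as a product, and the width of $G$ with respect to $S$ is $\mathrm{wid}(G,S)=\sup_{g\in G} l_S(g)\in\mathbb{N}\cup\{\infty\}$. A generating set $S$ is conjugation invariant if $g^{-1}sg\in S$ for all $s\in S$, $g\in G$. A group $G$ has finite $C$-width if $\mathrm{wid}(G,S)$ is finite for every conjugation invariant generating set $S$ of $G$; otherwise $G$ has infinite $C$-width. *)

(* Defs.v *)
(* An abstract, possibly infinite group is a groupType; its choiceType part
   costs no generality classically (gen_eqMixin and gen_choiceMixin in boolp). *)
From HB Require Import structures.
From mathcomp Require Import all_boot all_order all_algebra.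
From mathcomp Require Import boolp classical_sets constructive_ereal.

Set Implicit Arguments.
Unset Strict Implicit.
Unset Printing Implicit Defensive.

Local Open Scope quotient_scope.
Local Open Scope classical_set_scope.
Local Open Scope group_scope.

Section Width.
Variable G : groupType.
Implicit Types (H S : set G) (g : G).

Definition subgroup H : Prop := group_closed [in H].

Definition generates S : Prop := smallest subgroup S = setT.

Definition conj_invariant S : Prop := forall s g, S s -> S (s ^ g).

Definition words S : set (seq G) :=
  [set w | [set` w] `<=` S `|` [set s^-1 | s in S]].

(* The infimum is taken in nat, hence is a minimum. It has the default value 0
   on elements outside the subgroup generated by S; there are none when S
   generates G. *)
Definition word_length S g : nat :=
  infimum 0%N [set size w | w in [set w | words S w /\ \prod_(s <- w) s = g]].

(* \bar int stands in for the naturals extended with +oo; the set of lengths is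
   nonempty, so the default value 0 is never used. *)
Definition width S : \bar int :=
  supremum 0%E [set ((word_length S g)%:Z)%:E%E | g in [set: G]].

Definition finite_C_width : Prop :=
  forall S, generates S -> conj_invariant S -> (width S < +oo)%E.

Record normal_subgroup := NormalSubgroup {
  normal_set :> set G;
  normal_subgroupP : subgroup normal_set;
  normal_conjP : conj_invariant normal_set
}.

End Width.

Section Quotient.
Variables (G : groupType) (N : normal_subgroup G).
Implicit Types x y z : G.

(* x and y are identified when the cosets xN and yN coincide. *)
Definition coset_rel x y : bool := x^-1 * y \in (N : set G).

Lemma normal1 : 1 \in (N : set G).
Proof. by case: (normal_subgroupP N). Qed.

Lemma normalV x : x \in (N : set G) -> x^-1 \in (N : set G).
Proof. exact: (group_closedV (normal_subgroupP N)). Qed.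

Lemma normalM x y :
  x \in (N : set G) -> y \in (N : set G) -> x * y \in (N : set G).
Proof. exact: (group_closedM (normal_subgroupP N)). Qed.

Lemma normalJ x y : x \in (N : set G) -> x ^ y \in (N : set G).
Proof. by rewrite !inE; apply: normal_conjP. Qed.

Lemma coset_rel_equiv : equiv_class_of coset_rel.
Proof.
have sym x y : coset_rel x y -> coset_rel y x.
  by move=> /normalV; rewrite /coset_rel invgM invgK.
split=> [x|x y|y x z]; first by rewrite /coset_rel mulVg normal1.
- by apply/idP/idP; apply: sym.
- by move=> xy yz; have := normalM xy yz; rewrite -mulgA mulVKg.
Qed.

Canonical coset_equiv := EquivRelPack coset_rel_equiv.
Canonical coset_encModRel := defaultEncModRel coset_rel.

Definition quotient_group := {eq_quot coset_rel}.
HB.instance Definition _ := Choice.on quotient_group.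
HB.instance Definition _ : EqQuotient G coset_rel quotient_group :=
  EqQuotient.on quotient_group.

Definition quotient_one : quotient_group := lift_cst quotient_group 1.
Definition quotient_inv := lift_op1 quotient_group (fun x : G => x^-1).
Definition quotient_mul := lift_op2 quotient_group (fun x y : G => x * y).

Canonical pi_one_morph := PiConst quotient_one.

Lemma pi_inv : {morph \pi_quotient_group : x / x^-1 >-> quotient_inv x}.
Proof.
move=> x; unlock quotient_inv; apply/eqP; rewrite piE /coset_rel invgK.
set r := repr _.
have /(normalJ r^-1) : coset_rel r x by rewrite -eqmodE reprK.
by rewrite conjgE invgK -mulgA mulVKg.
Qed.
Canonical pi_inv_morph := PiMorph1 pi_inv.

Lemma pi_mul :
  {morph \pi_quotient_group : x y / x * y >-> quotient_mul x y}.
Proof.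
move=> x y; unlock quotient_mul; apply/eqP; rewrite piE /coset_rel.
set x' := repr _; set y' := repr _.
have xx' : coset_rel x x' by rewrite -eqmodE reprK.
have yy' : coset_rel y y' by rewrite -eqmodE reprK.
have := normalM (normalJ y xx') yy'.
by rewrite conjgE invgM -!mulgA mulVKg.
Qed.
Canonical pi_mul_morph := PiMorph2 pi_mul.

Lemma quotient_mulA : associative quotient_mul.
Proof. by move=> x y z; rewrite -[x]reprK -[y]reprK -[z]reprK !piE mulgA. Qed.

Lemma quotient_1mul : left_id quotient_one quotient_mul.
Proof. by move=> x; rewrite -[x]reprK !piE mul1g. Qed.

Lemma quotient_mul1 : right_id quotient_one quotient_mul.
Proof. by move=> x; rewrite -[x]reprK !piE mulg1. Qed.

Lemma quotient_Vmul : left_inverse quotient_one quotient_inv quotient_mul.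
Proof. by move=> x; rewrite -[x]reprK !piE mulVg. Qed.

Lemma quotient_mulV : right_inverse quotient_one quotient_inv quotient_mul.
Proof. by move=> x; rewrite -[x]reprK !piE mulgV. Qed.

HB.instance Definition _ := isGroup.Build quotient_group
  quotient_mulA quotient_1mul quotient_mul1 quotient_Vmul quotient_mulV.

End Quotient.

(* Main.v *)
Require Import Defs.
From mathcomp Require Import all_boot.
From HB Require Import structures.
From mathcomp Require Import order ssrint.
From mathcomp Require Import boolp classical_sets constructive_ereal.

Import Order.TTheory.
Local Open Scope quotient_scope.
Local Open Scope classical_set_scope.
Local Open Scope group_scope.

(** Finite C-width passes along any surjective homomorphism f : G -> H, and
    the theorem is the case of the projection onto the quotient.  Given a
    conjugation invariant generating set S of H, the set T of all x with
    f x in S or f x = 1 is conjugation invariant; it generates G because the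
    image under f of the subgroup it generates contains S, and because it
    contains the kernel.  Hence every element of G is a product of at most n
    letters from T and its inverse, for some n independent of the element.
    Applying f to such a product and erasing the letters that become trivial
    leaves a word in S of length at most n, so n bounds the length of every
    element of H.

    Including the kernel by allowing f x = 1, rather than taking the plain
    preimage of S, covers the case where S is empty and H trivial. *)

Section Length.
Context {G : groupType}.
Implicit Types (S : set G) (g : G) (w : seq G).

Lemma infimums_nat_neq0 (A : set nat) :
  A !=set0 -> exists2 m, A m & infimums A m.
Proof.
case=> n An; have exA : exists m, `[< A m >] by exists n; apply/asboolP.
case: (ex_minnP exA) => m /asboolP Am m_min; exists m => //.
by split=> [k Ak|k /(_ _ Am)//]; rewrite leEnat; apply/m_min/asboolP.
Qed.

Lemma infimum_nat_in (A : set nat) : A !=set0 -> A (infimum 0%N A).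
Proof.
move=> /[dup] A0 /infimums_nat_neq0[m Am infm].
rewrite /infimum ifF; last exact/negP/negP/set0P.
by rewrite (xget_subset1 _ infm)//; apply: is_subset1_infimums.
Qed.

Lemma infimum_nat_le (A : set nat) n : A n -> (infimum 0%N A <= n)%N.
Proof.
move=> An; rewrite -leEnat; apply: le_infimum_Nmem => //.
have [m _ infm] : exists2 m, A m & infimums A m.
  by apply: infimums_nat_neq0; exists n.
by exists m.
Qed.

Lemma word_length_le S w :
  words S w -> (word_length S (\prod_(s <- w) s) <= size w)%N.
Proof. by move=> Sw; apply: infimum_nat_le; exists w. Qed.

Lemma words_cat S w1 w2 : words S w1 -> words S w2 -> words S (w1 ++ w2).
Proof.
by move=> S1 S2 x /=; rewrite mem_cat => /orP[/S1|/S2].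
Qed.

Lemma words_rev_inv S w : words S w -> words S (rev [seq x^-1 | x <- w]).
Proof.
move=> Sw x /=; rewrite mem_rev => /mapP[y /Sw yS ->].
by case: yS => [Sy|[z Sz <-]]; [right; exists y | left; rewrite invgK].
Qed.

Lemma prodg_rev_inv w :
  \prod_(s <- rev [seq x^-1 | x <- w]) s = (\prod_(s <- w) s)^-1.
Proof.
elim: w => [|x w IHw]; first by rewrite !big_nil invg1.
by rewrite /= rev_cons big_rcons big_cons IHw invgM.
Qed.

(** The products of words in S form a subgroup containing S, so the set over
    which a word length is minimised is never empty when S generates. *)
Lemma generates_words S g :
  generates S -> exists w, words S w /\ \prod_(s <- w) s = g.
Proof.
move=> genS; pose P := [set g | exists w, words S w /\ \prod_(s <- w) s = g].
have : smallest (@subgroup G) S g by rewrite genS.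
apply: (@smallest_sub _ _ _ P) => [|s Ss]; last first.
  exists [:: s]; rewrite big_seq1; split=> // x /=.
  by rewrite inE => /eqP ->; left.
split; first by rewrite inE; exists [::]; rewrite big_nil.
move=> x y; rewrite !inE => -[w1 [Sw1 <-]] [w2 [Sw2 <-]].
exists (w1 ++ rev [seq x^-1 | x <- w2]); split.
  exact/words_cat/words_rev_inv.
by rewrite big_cat prodg_rev_inv.
Qed.

Lemma word_lengthP S g : generates S ->
  exists w, [/\ words S w, \prod_(s <- w) s = g & size w = word_length S g].
Proof.
move=> /(generates_words _ g)[w [Sw wg]].
by have [|v [Sv vg] sz] := infimum_nat_in
  [set size w | w in [set w | words S w /\ \prod_(s <- w) s = g]];
  [exists (size w), w | exists v].
Qed.

(** If the lengths are unbounded then +oo is their least upper bound, so the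
    default value of the supremum cannot make the width finite by accident. *)
Lemma width_finiteP S :
  (width S < +oo)%E <-> exists n, forall g, (word_length S g <= n)%N.
Proof.
split=> [ltS|[n leSn]]; last first.
  rewrite /width /supremum; case: ifPn => // _.
  case: xgetP => [y _ [_ /(_ n%:Z%:E%E) y_le]|//].
  apply: le_lt_trans (y_le _) (ltry _).
  by move=> _ [g _ <-]; rewrite lee_fin lez_nat.
apply: contrapT => unbounded; move: ltS.
suff -> : width S = +oo%E by rewrite ltxx.
have infty : supremums [set ((word_length S g)%:Z)%:E%E | g in [set: G]] +oo%E.
  split=> [_ [g _ <-]|[z||] z_ub//]; first exact: leey.
  - case: unbounded; exists `|z|%N => g.
    have := z_ub _ (ex_intro2 _ _ g I erefl); rewrite lee_fin => le_z.
    by rewrite -lez_nat (le_trans le_z)// lez_abs.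
  - by have := z_ub _ (ex_intro2 _ _ 1 I erefl).
rewrite /width /supremum ifF; last first.
  by apply/negP => /eqP/seteqP[/(_ _ (ex_intro2 _ _ 1 I erefl))].
by apply: xget_subset1 => //; apply: is_subset1_supremums.
Qed.

End Length.

Section Surjection.
Context {G H : groupType} (f : UMagmaMorphism.type G H).
Context (f_surj : forall y, exists x, f x = y) (S : set H).

Definition preimage1 : set G := f @^-1` (S `|` [set 1]).

Lemma preimage1_conj : conj_invariant S -> conj_invariant preimage1.
Proof.
move=> Sconj x g [Sx|fx1]; [left|right] => /=; rewrite gmulfJ.
  exact: Sconj.
by rewrite fx1 conj1g.
Qed.

Lemma preimage1_generates : generates S -> generates preimage1.
Proof.
move=> genS; rewrite /generates -subTset => g _ M [Msub TM].
have imf : subgroup (f @` M).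
  case: Msub; rewrite inE => M1 Mdiv; split.
    by rewrite inE; exists 1; rewrite ?gmulf1.
  move=> x y; rewrite !inE => -[a Ma <-] [b Mb <-].
  by exists (a / b); rewrite ?gmulfF// -in_setE Mdiv ?in_setE.
have : smallest (@subgroup H) S (f g) by rewrite genS.
move=> /(smallest_sub imf)[s Ss|m Mm fmg].
  by have [x fxs] := f_surj s; exists x => //; apply: TM; left; rewrite /= fxs.
(* m and g have the same image, so they differ by an element of the kernel. *)
have Mk : M (m^-1 * g) by apply: TM; right; rewrite /= gmulfM gmulfV fmg mulVg.
rewrite -[g](mulVKg m) -in_setE.
by apply: (group_closedM Msub); rewrite in_setE.
Qed.

(** Erasing the letters sent to 1 is what keeps the image a word in S: a
    letter of such a word is sent into S, into its inverse, or to 1. *)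
Lemma words_image w : words preimage1 w -> words S [seq y <- map f w | y != 1].
Proof.
move=> Tw y /=; rewrite mem_filter => /andP[y1 /mapP[x /Tw xT yE]].
move: y1; rewrite {}yE; case: xT => [[Sx _|/= ->]|[t [St|/= ft1] <-]].
- by left.
- by rewrite eqxx.
- by move=> _; right; exists (f t) => //; rewrite gmulfV.
- by rewrite gmulfV ft1 invg1 eqxx.
Qed.

Lemma prodg_image w :
  \prod_(y <- [seq y <- map f w | y != 1]) y = f (\prod_(x <- w) x).
Proof.
rewrite big_filter gmulf_prod -[RHS](big_map f xpredT id).
elim: (map f w) => [|y v IHv]; first by rewrite !big_nil.
by rewrite !big_cons; case: eqP => [->|_]; rewrite IHv ?mul1g.
Qed.

Lemma word_length_image g : generates preimage1 ->
  (word_length S (f g) <= word_length preimage1 g)%N.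
Proof.
move=> /(word_lengthP _ g)[w [Tw <- <-]].
rewrite -prodg_image (leq_trans (word_length_le _ _ (words_image _ Tw)))//.
by rewrite size_filter (leq_trans (count_size _ _))// size_map.
Qed.

End Surjection.

Lemma finite_C_width_surj {G H : groupType} (f : UMagmaMorphism.type G H) :
  (forall y, exists x, f x = y) -> finite_C_width G -> finite_C_width H.
Proof.
move=> f_surj fwG S genS Sconj.
have genT := preimage1_generates f f_surj S genS.
have /width_finiteP[n le_n] := fwG _ genT (preimage1_conj f S Sconj).
apply/width_finiteP; exists n => h.
have [g <-] := f_surj h.
exact: leq_trans (word_length_image f S g genT) (le_n g).
Qed.

Section Projection.
Context {G : groupType} (N : normal_subgroup G).

Definition quotient_proj (x : G) : quotient_group N :=
  \pi_(quotient_group N) x.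

Lemma quotient_projM : {morph quotient_proj : x y / x * y}.
Proof. exact: pi_mul. Qed.

Lemma quotient_proj1 : quotient_proj 1 = 1.
Proof. by rewrite /quotient_proj -[RHS]/(quotient_one N) piE. Qed.

HB.instance Definition _ := isMultiplicative.Build G (quotient_group N)
  quotient_proj quotient_projM.
HB.instance Definition _ := Multiplicative_isUMagmaMorphism.Build G
  (quotient_group N) quotient_proj quotient_proj1.

End Projection.

Theorem proposition4 (G : groupType) (hG : finite_C_width G)
  (N : normal_subgroup G) : finite_C_width (quotient_group N).
Proof.
apply: (@finite_C_width_surj _ _ (quotient_proj N)) hG => y.
by exists (repr y); apply: reprK.
Qed.
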